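(* The formula $\mathit{Uniq}$, namely $$\mathit{Uniq}:\qquad \bigwedge_{\mathcal{S}'\ne\mathcal{S}''}\lnot(\epsilon_{\mathcal{S}'}\land\epsilon_{\mathcal{S}''}),$$ where the conjunction ranges over all pairs of distinct full Sudoku grids $\mathcal{S}',\mathcal{S}''$, is an axiom of the deductive system of Sudoku logic, that is, $\mathit{Uniq}\in\Delta_{ax}$.
   Context: A Sudoku proposition is a formal symbol $r_ic_j \not\approx d$ with $i,j,d\in\{1,\dots,9\}$. Sudoku formulas are built inductively from Sudoku propositions and the constants $\top,\bot$ using $\lnot,\land,\lor,\Rightarrow,\Leftrightarrow$. A grid is a $9\times 9$ matrix $\mathcal{A}=[A_{ij}]_{9\times 9}$ of nonempty subsets $A_{ij}\subseteq\{1,\dots,9\}$; it is full if $|A_{ij}|=1$ for all $i,j$. Satisfaction $\mathcal{A}\models\phi$: $\mathcal{A}\models\top$ always, $\mathcal{A}\models\bot$ never, $\mathcal{A}\models r_ic_j\not\approx d$ iff $d\notin A_{ij}$, and the connectives are interpreted classically. A Sudoku grid is a grid such that whenever $A_{ij}=\{d\}$, the digit $d$ belongs to no $A_{\ell m}$ for any other cell in the same row, column or (standard $3\times 3$) box; a full Sudoku grid is a Sudoku grid that is full. There are finitely many full Sudoku grids. A Sudoku axiom is a Sudoku formula that holds in every full Sudoku grid; $\Delta_{ax}$ is the set of all Sudoku axioms. Write $r_ic_j\approx d$ for $\lnot(r_ic_j\not\approx d)$. For a full Sudoku grid $\mathcal{S}=[S_{ij}]_{9\times 9}$ with $S_{ij}=\{d_{ij}\}$,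 let $\epsilon_{\mathcal{S}}$ be the formula $\bigwedge_{1\le i,j\le 9} r_ic_j\approx d_{ij}$. *)

(* Defs.v *)
From HB Require Import structures.
From mathcomp Require Import all_boot all_order all_algebra.

Set Implicit Arguments.
Unset Strict Implicit.
Unset Printing Implicit Defensive.

(* Row and column indices and digits 1, ..., 9 are encoded as 0, ..., 8. *)
Definition idx := 'I_9.
Definition digit := 'I_9.

Inductive formula : Type :=
| FNeq of idx & idx & digit
| FTop
| FBot
| FNot of formula
| FAnd of formula & formula
| FOr of formula & formula
| FImp of formula & formula
| FIff of formula & formula.

Definition FEq (i j : idx) (d : digit) : formula := FNot (FNeq i j d).

(* There is no trailing FTop, except in the empty conjunction. *)
Fixpoint bigAnd (s : seq formula) : formula :=
  match s with
  | [::] => FTop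
  | [:: phi] => phi
  | phi :: s' => FAnd phi (bigAnd s')
  end.

Record grid := Grid {
  grid_mx :> 'M[{set digit}]_9;
  grid_nonempty : [forall i, forall j, grid_mx i j != set0]
}.

HB.instance Definition _ := [isSub for grid_mx].
HB.instance Definition _ := [Finite of grid by <:].

Fixpoint sat (A : grid) (phi : formula) : bool :=
  match phi with
  | FNeq i j d => d \notin A i j
  | FTop => true
  | FBot => false
  | FNot p => ~~ sat A p
  | FAnd p q => sat A p && sat A q
  | FOr p q => sat A p || sat A q
  | FImp p q => sat A p ==> sat A q
  | FIff p q => sat A p == sat A q
  end.

Definition same_box (i j l m : idx) : bool :=
  (i %/ 3 == l %/ 3) && (j %/ 3 == m %/ 3).

Definition peer (i j l m : idx) : bool :=
  ((i, j) != (l, m)) && [|| i == l, j == m | same_box i j l m].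

Definition full (A : grid) : bool := [forall i, forall j, #|A i j| == 1].

Definition sudoku (A : grid) : bool :=
  [forall i, forall j, forall d, (A i j == [set d]) ==>
     [forall l, forall m, peer i j l m ==> (d \notin A l m)]].

Record full_sudoku_grid := FullSudokuGrid {
  fsg_grid :> grid;
  fsg_prop : sudoku fsg_grid && full fsg_grid
}.

HB.instance Definition _ := [isSub for fsg_grid].
HB.instance Definition _ := [Finite of full_sudoku_grid by <:].

Definition Delta_ax : {pred formula} :=
  [pred phi | [forall S : full_sudoku_grid, sat S phi]].

Lemma fsg_cell (S : full_sudoku_grid) (i j : idx) :
  exists d : digit, S i j == [set d].
Proof.
have /andP[_ /forallP/(_ i)/forallP/(_ j)/cards1P[d Sd]] := fsg_prop S.
by exists d; apply/eqP.
Qed.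

Definition fsg_digit (S : full_sudoku_grid) (i j : idx) : digit :=
  xchoose (fsg_cell S i j).

Definition eps (S : full_sudoku_grid) : formula :=
  bigAnd [seq FEq c.1 c.2 (fsg_digit S c.1 c.2) | c <- enum {: idx * idx}].

(* The conjuncts are listed in the order of the canonical enumeration of the
   ordered pairs of distinct full Sudoku grids. *)
Definition Uniq : formula :=
  bigAnd [seq FNot (FAnd (eps p.1) (eps p.2))
         | p <- enum [pred p : full_sudoku_grid * full_sudoku_grid
                     | p.1 != p.2]].

(* Main.v *)
Require Import Defs.
From mathcomp Require Import all_boot all_order all_algebra.

(** [eps S] fixes the digit of every cell, so the only full Sudoku grid satisfying it is [S] itself
    ([sat_eps_inj]). A full grid satisfying both [eps S'] and [eps S''] would equal both, which is
    impossible for a distinct pair. *)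

Lemma sat_bigAnd (A : grid) (s : seq formula) :
  sat A (bigAnd s) = all (sat A) s.
Proof.
elim: s => [|phi [|psi s] IHs] //; first by rewrite /= andbT.
by rewrite [LHS]/= -/(bigAnd (psi :: s)) IHs.
Qed.

Lemma fsg_digitP (S : full_sudoku_grid) (i j : idx) :
  S i j = [set fsg_digit S i j].
Proof. exact/eqP/(xchooseP (fsg_cell S i j)). Qed.

Lemma sat_eps_inj (T S : full_sudoku_grid) : sat T (eps S) -> T = S.
Proof.
rewrite sat_bigAnd all_map => /allP epsT.
apply/val_inj/val_inj/matrixP => i j.
have := epsT (i, j); rewrite mem_enum => /(_ isT) /=.
(* The digit of [S] lies in the cell of [T], which is a singleton because [T] is full; hence the two
   digits agree. *)
by rewrite negbK !fsg_digitP inE => /eqP ->.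
Qed.

Theorem theorem9p1 : Uniq \in Delta_ax.
Proof.
rewrite inE; apply/forallP => S.
rewrite sat_bigAnd all_map; apply/allP => -[S' S''].
rewrite mem_enum inE /= => neqS; apply: contra neqS => /andP[S1 S2].
by rewrite -(sat_eps_inj _ _ S1) -(sat_eps_inj _ _ S2).
Qed.
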